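(* Let $X$ be a pervasive Archimedean pre-Riesz space, $p$ a semimonotone seminorm on $X$, and $(Y,i)$ a vector lattice cover of $X$. Define $p_r$ on $Y$ by \[p_r(y):=\inf\{p(x)\colon\, x\in X \text{ such that } -i(x)\le y\le i(x)\},\qquad y\in Y.\] If $p$ is order continuous on $X$, then $p_r$ is an order continuous seminorm on $Y$.
   Context: All spaces are real. A partially ordered vector space $X$ (with positive cone $X^+$) is Archimedean if $x,y\in X$ and $nx\le y$ for all $n\in\mathbb{N}$ imply $x\le 0$. For a finite set $M\subset X$, $M^{\mathrm u}$ denotes its set of upper bounds. $X$ is a pre-Riesz space if for all $x,y,z\in X$ the inclusion $\{x+y,x+z\}^{\mathrm u}\subseteq\{y,z\}^{\mathrm u}$ implies $x\ge 0$. A linear map $i\colon X\to Y$ is bipositive if $x\ge 0\iff i(x)\ge 0$. A subspace $D$ of $Y$ is order dense in $Y$ if $y=\inf\{d\in D\colon d\ge y\}$ for every $y\in Y$. A vector lattice cover of $X$ is a pair $(Y,i)$ with $Y$ a vector lattice and $i\colon X\to Y$ a bipositive linear map such that $i(X)$ is order dense in $Y$. The Riesz completion $(X^\rho,i)$ of $X$ is the (essentially unique) vector lattice cover such that in addition $i(X)$ generates $X^\rho$ as a vector lattice. $X$ is pervasive if for every $y\in X^\rho$ with $y>0$ there is $x\in X$ with $0<i(x)\le y$. A net $(x_\alpha)$ in a partially ordered vector space order converges to $x$ if there is a net $(y_\beta)$ with $y_\beta\downarrow 0$ such that for every $\beta$ there is $\alpha_0$ with $\pm(x_\alpha-x)\le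 y_\beta$ for all $\alpha\ge\alpha_0$. A seminorm $p$ is order continuous if $p(x_\alpha-x)\to 0$ whenever $(x_\alpha)$ order converges to $x$. A seminorm $p$ is semimonotone if there is a constant $C\ge 0$ with $p(x)\le C\,p(y)$ whenever $0\le x\le y$. *)

(* Defs.v *)
From HB Require Import structures.
From mathcomp Require Import all_boot all_order all_algebra.
From mathcomp Require Import boolp classical_sets reals.

Set Implicit Arguments.
Unset Strict Implicit.
Unset Printing Implicit Defensive.

Import Order.TTheory GRing.Theory Num.Theory.
Local Open Scope classical_set_scope.
Local Open Scope ring_scope.

(* [porderZmodType] does not relate the order and the group structure, so
   compatibility with translations is required here as well. *)
HB.mixin Record isOrderedVectorSpace (R : numDomainType) X
    of Num.POrderedZmodule X & GRing.Lmodule R X := {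
  lev_add2r : forall x y z : X, x <= y -> x + z <= y + z;
  lev_wpscale2l : forall (a : R) (x y : X), 0 <= a -> x <= y -> a *: x <= a *: y
}.

#[short(type="povectType")]
HB.structure Definition OrderedVectorSpace (R : numDomainType) :=
  { X of isOrderedVectorSpace R X & Num.POrderedZmodule X & GRing.Lmodule R X }.

(* Hierarchy-Builder refuses a join of [Order.Lattice] with [OrderedVectorSpace]
   (it would have to sit below [Num.RealDomain]), hence dedicated operations;
   the axioms are the library's characterization of binary lub and glb. *)
HB.mixin Record OrderedVectorSpace_isLattice (R : numDomainType) X
    of OrderedVectorSpace R X := {
  vjoin : X -> X -> X;
  vmeet : X -> X -> X;
  vleUx : forall x y z : X, (vjoin x y <= z) = (x <= z) && (y <= z);
  vlexI : forall x y z : X, (x <= vmeet y z) = (x <= y) && (x <= z)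
}.

#[short(type="vlatticeType")]
HB.structure Definition VectorLattice (R : numDomainType) :=
  { X of OrderedVectorSpace_isLattice R X & OrderedVectorSpace R X }.

Definition archimedean_pov (R : numDomainType) (X : povectType R) : Prop :=
  forall x y : X, (forall n : nat, x *+ n <= y) -> x <= 0.

Definition pre_riesz (R : numDomainType) (X : povectType R) : Prop :=
  forall x y z : X,
    ubound [set x + y; x + z] `<=` ubound [set y; z] -> 0 <= x.

Definition bipositive (R : numDomainType) (X Y : povectType R)
    (i : {linear X -> Y}) : Prop :=
  forall x : X, 0 <= x <-> 0 <= i x.

(* [infimums A y] says that [y] is the greatest lower bound of [A]. *)
Definition order_dense (R : numDomainType) (Y : povectType R) (D : set Y) : Prop :=
  forall y : Y, infimums [set d | D d /\ y <= d] y.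

Definition vector_lattice_cover (R : numDomainType) (X : povectType R)
    (Y : vlatticeType R) (i : {linear X -> Y}) : Prop :=
  bipositive i /\ order_dense (range i).

Definition vector_sublattice (R : numDomainType) (Y : vlatticeType R)
    (S : set Y) : Prop :=
  [/\ S 0,
      forall x y, S x -> S y -> S (x + y),
      forall (a : R) x, S x -> S (a *: x),
      forall x y, S x -> S y -> S (vjoin x y)
    & forall x y, S x -> S y -> S (vmeet x y)].

Definition riesz_completion (R : numDomainType) (X : povectType R)
    (Z : vlatticeType R) (j : {linear X -> Z}) : Prop :=
  vector_lattice_cover j /\ smallest (@vector_sublattice R Z) (range j) = setT.

(* The Riesz completion of a pre-Riesz space exists and is unique up to an
   isomorphism over [X], so the choice of [Z] and [j] is immaterial. *)
Definition pervasive (R : numDomainType) (X : povectType R) : Prop :=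
  exists (Z : vlatticeType R) (j : {linear X -> Z}),
    riesz_completion j /\
    forall z : Z, 0 < z -> exists x : X, 0 < j x /\ j x <= z.

Definition directed_preorder (I : Type) (leI : I -> I -> Prop) : Prop :=
  [/\ inhabited I,
      forall a, leI a a,
      forall a b c, leI a b -> leI b c -> leI a c
    & forall a b, exists c, leI a c /\ leI b c].

Definition decreases_to0 (R : numDomainType) (X : povectType R)
    (J : Type) (leJ : J -> J -> Prop) (y : J -> X) : Prop :=
  (forall b b', leJ b b' -> y b' <= y b) /\ infimums (range y) 0.

(* The dominating net [y] may have an index set different from that of [x]. *)
Definition order_converges (R : numDomainType) (X : povectType R)
    (I : Type) (leI : I -> I -> Prop) (x : I -> X) (l : X) : Prop :=
  exists (J : Type) (leJ : J -> J -> Prop) (y : J -> X),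
    [/\ directed_preorder leJ, decreases_to0 leJ y
      & forall b, exists a0, forall a, leI a0 a ->
          x a - l <= y b /\ - (x a - l) <= y b].

Definition net_cvg0 (R : numDomainType) (I : Type) (leI : I -> I -> Prop)
    (u : I -> R) : Prop :=
  forall e : R, 0 < e -> exists a0, forall a, leI a0 a -> `|u a| < e.

Definition seminorm (R : numDomainType) (X : lmodType R) (p : X -> R) : Prop :=
  [/\ forall x, 0 <= p x,
      forall x y, p (x + y) <= p x + p y
    & forall (a : R) x, p (a *: x) = `|a| * p x].

Definition order_continuous (R : numDomainType) (X : povectType R)
    (p : X -> R) : Prop :=
  forall (I : Type) (leI : I -> I -> Prop) (x : I -> X) (l : X),
    directed_preorder leI -> order_converges leI x l ->
    net_cvg0 leI (fun a => p (x a - l)).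

Definition semimonotone (R : numDomainType) (X : povectType R)
    (p : X -> R) : Prop :=
  exists2 C : R, 0 <= C & forall x y : X, 0 <= x -> x <= y -> p x <= C * p y.

Definition regular_ext (R : realType) (X Y : povectType R)
    (i : {linear X -> Y}) (p : X -> R) (y : Y) : R :=
  inf [set p x | x in [set x : X | - i x <= y /\ y <= i x]].

(* Main.v *)
Require Import Defs.
From HB Require Import structures.
From mathcomp Require Import all_boot all_order all_algebra.
From mathcomp Require Import boolp classical_sets reals.
Import Order.TTheory GRing.Theory Num.Theory.
Local Open Scope ring_scope.

(** [regular_ext i p] is a seminorm because [i X] majorizes [Y], so that the
    infima are over nonempty sets.

    For order continuity, let the net [z] decrease to [0] in [Y], and let
    [z b0 <= i x0].  It suffices to find elements of [X] above some [z b] with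
    small [p], since such an element bounds every [y] with [|y| <= z b].  The
    elements of [X] above some [z b] have infimum [0], but they need not be
    directed downwards, because [X] has no lattice operations; so the order
    continuity of [p] does not apply to them.

    The remedy is to allow an error [d *: x0] with a small real [d > 0], and to
    consider the positive [u <= x0] in [X] whose image is disjoint from
    [(z b - d x0)^+] for some [b].  For such a [u], both [i u] and
    [(z b - d x0)^+] lie below [i x0] once [b] is large, and so does their sum
    as they are disjoint; hence [z b <= i (d x0 + (x0 - u))].  Disjointness
    makes this family stable under addition as long as the sum stays below
    [x0].  A maximal upward directed part [V] of the family has supremum [x0]:
    if [w] separated [V] from [x0], pervasiveness would give a small positive
    [e] with [V + e] still in the family, maximality would force
    [V + e] into [V], and then all multiples of [e] would be bounded,
    against the Archimedean property ([directed_exhaustion]).  Hence [x0 - u],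
    for [u] in [V], is a net in [X] decreasing to [0], and
    [p (d x0 + (x0 - u))] is eventually small.

    Pervasiveness refers to the Riesz completion, but the part of it that is
    used, an element of [X] between [0] and [y > 0], carries over to every
    vector lattice cover ([pervasive_cover]). *)

(** * Ordered vector spaces *)

Section OrderedVectorSpaceTheory.
Context {R : numDomainType} {X : povectType R}.
Implicit Types x y z : X.

Lemma lev_addr x y z : (x + z <= y + z) = (x <= y).
Proof.
apply/idP/idP => [h|]; last exact: lev_add2r.
by have := lev_add2r _ _ (- z) h; rewrite !addrK.
Qed.

Lemma lev_addl x y z : (z + x <= z + y) = (x <= y).
Proof. by rewrite ![z + _]addrC lev_addr. Qed.

Lemma lev_add x y x' y' : x <= y -> x' <= y' -> x + x' <= y + y'.
Proof.
move=> h h'; apply: (le_trans (y := y + x')); first by rewrite lev_addr.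
by rewrite lev_addl.
Qed.

Lemma lev_subr x y z : (x <= y - z) = (x + z <= y).
Proof. by rewrite -(lev_addr x _ z) subrK. Qed.

Lemma lev_subl x y z : (x - z <= y) = (x <= y + z).
Proof. by rewrite -(lev_addr _ y z) subrK. Qed.

Lemma subv_ge0 x y : (0 <= y - x) = (x <= y).
Proof. by rewrite lev_subr add0r. Qed.

Lemma scalev_le (a : R) x : a <= 1 -> 0 <= x -> a *: x <= x.
Proof.
move=> a1 x0; rewrite -subv_ge0 -{1}[x]scale1r -scalerBl -(scaler0 X (1 - a)).
by rewrite lev_wpscale2l // subr_ge0.
Qed.

Lemma lev_opp x y : (- x <= - y) = (y <= x).
Proof. by rewrite -[- x]add0r lev_subl addrC lev_subr add0r. Qed.

End OrderedVectorSpaceTheory.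

Lemma scalev_gt0 {R : numFieldType} {X : povectType R} (a : R) (x : X) :
  0 < a -> 0 < x -> 0 < a *: x.
Proof.
move=> a0 x0; rewrite lt_neqAle -{2}(scaler0 X a) lev_wpscale2l ?ltW // andbT.
by rewrite eq_sym scaler_eq0 negb_or !gt_eqF.
Qed.

(** * Positive parts and disjointness in vector lattices *)

Section VectorLatticeTheory.
Context {R : numDomainType} {Y : vlatticeType R}.
Implicit Types a b c w x y : Y.

Definition pos_part x : Y := vjoin x 0.

(** For positive elements this is the usual condition that the meet is [0];
    the inequality passes to smaller elements, positive or not. *)
Definition disjoint_elts a b := vmeet a b <= 0.

Lemma lev_joinl x y : x <= vjoin x y.
Proof. by have := lexx (vjoin x y); rewrite vleUx => /andP[]. Qed.

Lemma lev_joinr x y : y <= vjoin x y.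
Proof. by have := lexx (vjoin x y); rewrite vleUx => /andP[]. Qed.

Lemma pos_part_ge0 x : 0 <= pos_part x.
Proof. exact: lev_joinr. Qed.

Lemma pos_part_ge x : x <= pos_part x.
Proof. exact: lev_joinl. Qed.

Lemma pos_part_le x y : (pos_part x <= y) = (x <= y) && (0 <= y).
Proof. exact: vleUx. Qed.

Lemma le_pos_part {x y} : x <= y -> pos_part x <= pos_part y.
Proof.
move=> xy; rewrite pos_part_le pos_part_ge0 andbT.
exact: le_trans xy (pos_part_ge y).
Qed.

Lemma pos_part_gt0 {x} : ~ x <= 0 -> 0 < pos_part x.
Proof.
move=> xn0; rewrite lt_neqAle pos_part_ge0 andbT; apply/eqP => x0.
by apply: xn0; rewrite x0 pos_part_ge.
Qed.

Lemma disjoint_eltsP a b :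
  disjoint_elts a b <-> (forall w, w <= a -> w <= b -> w <= 0).
Proof.
split=> [ab w wa wb|ab]; first by apply: le_trans ab; rewrite vlexI wa.
by have := lexx (vmeet a b); rewrite vlexI => /andP[]; apply: ab.
Qed.

Lemma disjoint_elts_le {a a' b b'} :
  a <= a' -> b <= b' -> disjoint_elts a' b' -> disjoint_elts a b.
Proof.
move=> aa' bb' /disjoint_eltsP ab; apply/disjoint_eltsP => w wa wb.
by apply: ab; [apply: le_trans aa' | apply: le_trans bb'].
Qed.

Lemma disjoint_elts_add {a b c} : 0 <= b ->
  disjoint_elts a c -> disjoint_elts b c -> disjoint_elts (a + b) c.
Proof.
move=> b0 /disjoint_eltsP ac /disjoint_eltsP bc.
apply/disjoint_eltsP => w wab wc; apply: bc => //.
(* If [w <= a + b] and [w <= c], then [w - b] is below both [a] and [c]. *)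
rewrite -[b]add0r -lev_subl; apply: ac; rewrite lev_subl //.
by apply: le_trans wc _; rewrite -{1}[c]addr0 lev_addl.
Qed.

(** [a + c] is the sum of the join and the meet of [a] and [c], and the meet is
    at most [0]. *)
Lemma disjoint_elts_add_le {a c x} :
  disjoint_elts a c -> a <= x -> c <= x -> a + c <= x.
Proof.
move=> /disjoint_eltsP ac ax cx; rewrite -[x]add0r -lev_subl; apply: ac.
  by rewrite lev_subl lev_addl.
by rewrite lev_subl addrC lev_addl.
Qed.

Lemma disjoint_pos_part_opp x : disjoint_elts (pos_part x) (pos_part (- x)).
Proof.
apply/disjoint_eltsP => w wp wn.
have wp' : w <= pos_part x - x.
  apply: le_trans wn _; rewrite pos_part_le subv_ge0 pos_part_ge andbT.
  by rewrite -{1}[- x]add0r lev_addr pos_part_ge0.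
have : pos_part x <= pos_part x - w.
  rewrite pos_part_le subv_ge0 wp andbT.
  by rewrite lev_subr addrC -lev_subr.
by rewrite lev_subr -{2}[pos_part x]addr0 lev_addl.
Qed.

End VectorLatticeTheory.

(** * Exhaustion by directed sets *)

Section Exhaustion.
Context {R : numDomainType} {X : povectType R}.
Local Open Scope classical_set_scope.

Definition upward_directed (V : set X) :=
  forall u v, V u -> V v -> exists t, [/\ V t, u <= t & v <= t].

(** Zorn's lemma is applied to directed sets rather than to chains because the
    extension step passes from [V] to [V `|` (V + e)], which is directed but
    need not be a chain. *)
Lemma directed_exhaustion (U : set X) (x0 : X) :
  archimedean_pov X -> U !=set0 -> (forall u, U u -> u <= x0) ->
  (forall w u0, ~ w <= 0 -> U u0 -> u0 + w <= x0 ->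
    exists2 e, 0 < e & forall u, U u -> u + w <= x0 -> U (u + e)) ->
  exists V : set X, [/\ V `<=` U, V !=set0, upward_directed V
    & forall w, (forall u, V u -> u + w <= x0) -> w <= 0].
Proof.
move=> archX [u1 Uu1] Ux0 extU.
have [F FP Ftot|V [[VU Vdir] Vmax]] :=
  @Zorn_bigcup X (fun V => V `<=` U /\ upward_directed V).
  split=> [x [A FA Ax]|u v [A FA Au] [B FB Bv]]; first exact: (FP A FA).1.
  have [AB|BA] := Ftot A B FA FB.
    have [t [Bt ut vt]] := (FP B FB).2 u v (AB _ Au) Bv.
    by exists t; split=> //; exists B.
  have [t [At ut vt]] := (FP A FA).2 u v Au (BA _ Bv).
  by exists t; split=> //; exists A.
have [u0 Vu0] : V !=set0.
  apply: contrapT => V0; apply: (Vmax [set u1]); last first.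
    split=> [_ -> //|_ _ -> ->]; by exists u1.
  split=> [x Vx|/(_ u1 erefl) Vu1]; first by case: V0; exists x.
  by apply: V0; exists u1.
exists V; split=> //; first by exists u0.
move=> w Vw; apply: contrapT => w0.
have [e e0 extV] := extU w u0 w0 (VU _ Vu0) (Vw _ Vu0).
pose V' := V `|` [set u + e | u in V].
have V'U : V' `<=` U.
  by move=> _ [/VU //|[u Vu <-]]; apply: extV (VU _ Vu) (Vw _ Vu).
have V'dir : upward_directed V'.
  have up t : t <= t + e by rewrite -{1}[t]addr0 lev_addl ltW.
  have below x : V' x -> exists2 u, V u & x <= u + e.
    by move=> [Vx|[u Vu <-]]; [exists x|exists u].
  move=> x y /below[u Vu xu] /below[v Vv yv].
  have [t [Vt ut vt]] := Vdir u v Vu Vv.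
  exists (t + e); split; first by right; exists t.
    by apply: le_trans xu _; rewrite lev_addr.
  by apply: le_trans yv _; rewrite lev_addr.
have V'V : V' `<=` V.
  apply: contrapT => nV'V; apply: (Vmax V') => //.
  by split=> // u Vu; left.
have Vne n : V (u0 + e *+ n).
  elim: n => [|n Vn]; first by rewrite mulr0n addr0.
  by rewrite mulrSr addrA; apply: V'V; right; exists (u0 + e *+ n).
have : e <= 0.
  apply: (archX e (x0 - u0)) => n.
  by rewrite lev_subr addrC; apply: Ux0; apply: VU.
by move=> /(lt_le_trans e0); rewrite ltxx.
Qed.

End Exhaustion.

(** * Vector lattice covers *)

Section Cover.
Context {R : realType} {X : povectType R} {Y : vlatticeType R}.
Context {i : {linear X -> Y}}.
Hypothesis icover : vector_lattice_cover i.

Lemma cover_le x y : (i x <= i y) = (x <= y).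
Proof.
rewrite -[LHS]subv_ge0 -[RHS]subv_ge0 -linearB.
by apply/idP/idP => /(icover.1 _).
Qed.

(** Were no element of [i X] above [y], every element of [Y] would be a lower
    bound of the empty set, and [y] the largest element of [Y], hence [0]. *)
Lemma cover_majorizing (y : Y) : exists x, y <= i x.
Proof.
apply: contrapT => no; have [_ ymax] := icover.2 y.
have /ymax : lbound [set d | range i d /\ y <= d]%classic (y + y).
  by move=> _ [[x _ <-] yx]; case: no; exists x.
rewrite -{3}[y]addr0 lev_addl => y0.
by apply: no; exists 0; rewrite linear0.
Qed.

Lemma cover_abs_majorizing (y : Y) : exists x, - i x <= y /\ y <= i x.
Proof.
have [x] := cover_majorizing (vjoin y (- y)); rewrite vleUx => /andP[yx nyx].
by exists x; split=> //; rewrite -lev_opp opprK.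
Qed.

Lemma cover_glb {y w : Y} : (forall x, y <= i x -> w <= i x) -> w <= y.
Proof.
move=> h; have [_ ymax] := icover.2 y.
by apply: ymax => _ [[x _ <-] yx]; apply: h.
Qed.

Lemma cover_lub {y w : Y} : (forall x, i x <= y -> i x <= w) -> y <= w.
Proof.
move=> h; rewrite -lev_opp; apply: cover_glb => x yx.
rewrite -lev_opp opprK -linearN; apply: h.
by rewrite linearN -lev_opp opprK.
Qed.

End Cover.

(** Given [y > 0], order density yields [x] with [i x <= y] and [i x] not
    below [0].  An element of [X] is below the positive part of [x] in one cover
    if and only if it is in the other, since the positive part is the infimum
    of the elements of [X] above both [x] and [0]. *)
Lemma pervasive_cover {R : realType} {X : povectType R} {Y : vlatticeType R}
    {i : {linear X -> Y}} :
  pervasive X -> vector_lattice_cover i ->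
  forall y : Y, 0 < y -> exists2 e : X, 0 < e & i e <= y.
Proof.
move=> [Z [j [[jcov _] perv]]] icov y y0.
have [x xy xn0] : exists2 x, i x <= y & ~ x <= 0.
  apply: contrapT => no; have : y <= 0.
    apply: (cover_lub icov) => x xy; rewrite -(linear0 i) (cover_le icov).
    by apply: contrapT => xn0; apply: no; exists x.
  by move=> /(lt_le_trans y0); rewrite ltxx.
have [|e [e0 ex]] := perv (pos_part (j x)).
  by apply: pos_part_gt0; rewrite -(linear0 j) (cover_le jcov).
exists e.
  rewrite lt_neqAle -(cover_le jcov) linear0 (ltW e0) andbT.
  by apply/eqP => e00; move: e0; rewrite -e00 linear0 ltxx.
apply: (le_trans (y := pos_part (i x))); last by rewrite pos_part_le xy ltW.
apply: (cover_glb icov) => d; rewrite pos_part_le => /andP[xd d0].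
rewrite (cover_le icov) -(cover_le jcov); apply: le_trans ex _.
by rewrite pos_part_le (cover_le jcov) -(cover_le icov) xd; apply/jcov.1/icov.1.
Qed.

Section DecreasingNets.
Context {R : realType} {X : povectType R} {Y : vlatticeType R}.
Context {i : {linear X -> Y}}.
Hypotheses (archX : archimedean_pov X) (pervX : pervasive X).
Hypothesis icover : vector_lattice_cover i.
Context {J : Type} {leJ : J -> J -> Prop} {z : J -> Y}.
Hypotheses (dirJ : directed_preorder leJ) (z_dec : decreases_to0 leJ z).

Lemma decreases_to0_ge0 b : 0 <= z b.
Proof. by apply: z_dec.2.1; exists b. Qed.

(** As [z] decreases to [0], some [(v - z b)^+] is nonzero.  It lies below both
    [v] and [(a - z b)^+], and the latter is disjoint from [(z b - a)^+]. *)
Lemma exists_disjoint_elt {a v : Y} : 0 < v -> v <= a ->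
  exists e b, [/\ 0 < e, i e <= v & disjoint_elts (i e) (pos_part (z b - a))].
Proof.
move=> v0 va.
have [b vb] : exists b, ~ v - z b <= 0.
  apply: contrapT => no; have : v <= 0.
    apply: z_dec.2.2 => _ [b _ <-]; apply: contrapT => nvb; apply: no.
    by exists b; rewrite lev_subl add0r.
  by move=> /(lt_le_trans v0); rewrite ltxx.
have [e e0 ev] := pervasive_cover pervX icover _ (pos_part_gt0 vb).
exists e, b; split=> //.
  apply: le_trans ev _; rewrite pos_part_le (ltW v0) andbT lev_subl.
  by rewrite -{1}[v]addr0 lev_addl decreases_to0_ge0.
have := disjoint_pos_part_opp (a - z b); rewrite opprB.
apply: disjoint_elts_le (lexx _); apply: le_trans ev _.
by apply: le_pos_part; rewrite lev_addr.
Qed.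

(** The family to be exhausted consists of the positive [u <= x0] whose image is
    disjoint from some [(z b - d x0)^+].  The condition [d <= 1] ensures that
    an element added to it, which is at most [d w^+], fits into the room [w^+]
    that is left below [x0]. *)
Lemma exhaustion_below_net {b0 : J} {x0 : X} {d : R} :
  z b0 <= i x0 -> 0 < d -> d <= 1 ->
  exists V : set X, [/\ (V !=set0)%classic, upward_directed V,
    forall u, V u -> u <= x0,
    forall w, (forall u, V u -> u + w <= x0) -> w <= 0
  & forall u, V u -> exists b, z b <= i (d *: x0 + (x0 - u))].
Proof.
move=> zx0 d0 d1; have ix0 := le_trans (decreases_to0_ge0 b0) zx0.
have x00 : 0 <= x0 by apply/icover.1.
have dx0 : 0 <= d *: x0 by rewrite -(scaler0 X d) lev_wpscale2l // ltW.
have idx0 : 0 <= i (d *: x0) by apply/icover.1.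
case: (dirJ) => _ _ _ updir.
pose tail b := pos_part (z b - i (d *: x0)).
have le_tail b b' : leJ b b' -> tail b' <= tail b.
  by move=> bb'; apply: le_pos_part; rewrite lev_addr; apply: z_dec.1.
pose U : set X := fun u =>
  [/\ 0 <= u, u <= x0 & exists b, disjoint_elts (i u) (tail b)].
have [||w u0 wn0 [u00 _ _] uw|V [VU V0 Vdir Vsup]] :=
  @directed_exhaustion R X U x0 archX.
- exists 0; split=> //; exists b0; apply/disjoint_eltsP => w.
  by rewrite linear0.
- by move=> u [].
- have wp0 : 0 < pos_part (i w).
    by apply: pos_part_gt0; rewrite -(linear0 i) (cover_le icover).
  have wx0 : pos_part (i w) <= i x0.
    rewrite pos_part_le ix0 andbT (cover_le icover); apply: le_trans uw.
    by rewrite -{1}[w]add0r lev_addr.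
  have v0 : 0 < d *: pos_part (i w) by apply: scalev_gt0.
  have va : d *: pos_part (i w) <= i (d *: x0).
    by rewrite linearZ lev_wpscale2l // ltW.
  have [e [b [e0 ev eb]]] := exists_disjoint_elt v0 va.
  exists e => // u [u0' ux0 [b' ub']] uwx0; split.
  + by rewrite -[0]addr0; apply: lev_add => //; apply: ltW.
  + rewrite -(cover_le icover) linearD addrC -lev_subr.
    apply: le_trans ev (le_trans (scalev_le _ _ d1 (pos_part_ge0 _)) _).
    rewrite pos_part_le -linearB (cover_le icover) lev_subr addrC uwx0.
    by apply/icover.1; rewrite subv_ge0.
  + have [c [bc b'c]] := updir b b'.
    exists c; rewrite linearD; apply: disjoint_elts_add.
    * by apply/icover.1/ltW.
    * exact: disjoint_elts_le (lexx _) (le_tail _ _ b'c) ub'.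
    * exact: disjoint_elts_le (lexx _) (le_tail _ _ bc) eb.
exists V; split=> // [u /VU[] //|u /VU[_ ux0 [b ub]]].
have [c [b0c bc]] := updir b0 b; exists c.
have tail_le : tail c <= i x0.
  rewrite pos_part_le ix0 andbT lev_subl; apply: le_trans (z_dec.1 _ _ b0c) _.
  by apply: le_trans zx0 _; rewrite -{1}[i x0]addr0 lev_addl.
have iux0 : i u <= i x0 by rewrite (cover_le icover).
have ut := disjoint_elts_add_le
  (disjoint_elts_le (lexx _) (le_tail _ _ bc) ub) iux0 tail_le.
rewrite linearD linearB addrC -lev_subl lev_subr addrC.
by apply: le_trans ut; rewrite lev_addl pos_part_ge.
Qed.

(** Directedness of [V] is what turns [x0 - u], for [u] in [V], into a
    decreasing net, to which order continuity applies. *)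
Lemma order_continuous_small_bound {p : X -> R} {eps : R} :
  seminorm p -> order_continuous p -> 0 < eps ->
  exists b x, z b <= i x /\ p x < eps.
Proof.
move=> [p0 pD pZ] pcont eps0; case: (dirJ) => [[b0] _ _ _].
have [x0 zx0] := cover_majorizing icover (z b0).
have den0 : 0 < 2 * (p x0 + 1).
  by rewrite mulr_gt0 // ltr_wpDl.
(* This choice makes [d * p x0] smaller than [eps / 2]. *)
pose d := Num.min 1 (eps / (2 * (p x0 + 1))).
have d0 : 0 < d by rewrite lt_min ltr01 divr_gt0.
have d1 : d <= 1 by rewrite ge_min lexx.
have dp : d * p x0 <= eps / 2.
  apply: (le_trans (y := eps / (2 * (p x0 + 1)) * (p x0 + 1))).
    apply: ler_pM => //; first exact: ltW.
      by rewrite /d ge_min lexx orbT.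
    by rewrite lerDl.
  by rewrite invfM mulrA divfK // gt_eqF // ltr_wpDl.
have [V [[u1 Vu1] Vdir Vx0 Vsup Vz]] := exhaustion_below_net zx0 d0 d1.
pose I := {u : X | V u}; pose leI (u v : I) := sval u <= sval v.
pose x (u : I) := x0 - sval u.
have dirI : directed_preorder leI.
  split=> [|u|u v t|[u Vu] [v Vv]]; first exact: (inhabits (exist _ u1 Vu1)).
  - exact: lexx.
  - exact: le_trans.
  - by have [t [Vt ut vt]] := Vdir u v Vu Vv; exists (exist _ t Vt).
have x_ge0 u : 0 <= x u by rewrite subv_ge0; apply/Vx0/(svalP u).
have x_dec u v : leI u v -> x v <= x u.
  by move=> uv; rewrite lev_addl lev_opp.
have x_cvg : order_converges leI x 0.
  exists I, leI, x; split=> [//||u].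
    split=> //; split=> [_ [u _ <-]|w wx]; first exact: x_ge0.
    apply: Vsup => u Vu; rewrite addrC -lev_subr; apply: wx.
    by exists (exist _ u Vu).
  exists u => v uv; rewrite subr0 x_dec //; split=> //.
  by apply: le_trans (x_ge0 u); rewrite -(oppr0 X) lev_opp.
have e2 : 0 < eps / 2 by rewrite divr_gt0.
have [u /(_ u (lexx _))] := pcont I leI x 0 dirI x_cvg (eps / 2) e2.
rewrite subr0 ger0_norm // => pxu.
have [b zb] := Vz _ (svalP u).
exists b, (d *: x0 + x u); split=> //.
apply: le_lt_trans (pD _ _) _; rewrite pZ ger0_norm ?(ltW d0) //.
by rewrite [eps]splitr ler_ltD.
Qed.

End DecreasingNets.

(** * The regular extension of a seminorm *)

Section RegularExtension.
Context {R : realType} {X : povectType R} {Y : vlatticeType R}.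
Context {i : {linear X -> Y}} {p : X -> R}.
Hypotheses (icover : vector_lattice_cover i) (p_seminorm : seminorm p).

Lemma regular_ext_le y x : - i x <= y -> y <= i x -> regular_ext i p y <= p x.
Proof.
move=> nxy yx; apply: ge_inf; last by exists x.
by exists 0 => _ [t _ <-]; case: p_seminorm.
Qed.

Lemma le_regular_ext y c : (forall x, - i x <= y -> y <= i x -> c <= p x) ->
  c <= regular_ext i p y.
Proof.
move=> h; apply: lb_le_inf => [|_ [x [nxy yx] <-]]; last exact: h.
by have [x yx] := cover_abs_majorizing icover y; exists (p x), x.
Qed.

Lemma regular_ext_ge0 y : 0 <= regular_ext i p y.
Proof. by apply: le_regular_ext => x _ _; case: p_seminorm. Qed.

Lemma regular_ext_add y y' :
  regular_ext i p (y + y') <= regular_ext i p y + regular_ext i p y'.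
Proof.
have [_ pD _] := p_seminorm.
rewrite -lerBlDr; apply: le_regular_ext => x nxy yx.
rewrite lerBlDr [p x + _]addrC -lerBlDr; apply: le_regular_ext => x' nxy' yx'.
rewrite lerBlDr [_ + p x]addrC; apply: le_trans (pD _ _); apply: regular_ext_le.
  by rewrite linearD opprD lev_add.
by rewrite linearD lev_add.
Qed.

Lemma regular_ext_scale_le a y :
  regular_ext i p (a *: y) <= `|a| * regular_ext i p y.
Proof.
have [_ _ pZ] := p_seminorm.
have dom x : - i x <= y -> y <= i x -> regular_ext i p (a *: y) <= `|a| * p x.
  move=> nxy yx.
  have nyx : - y <= i x by rewrite -lev_opp opprK.
  rewrite -[`|a|]normr_id -pZ; apply: regular_ext_le.
    rewrite linearZ -lev_opp opprK; case: (ger0P a) => a0.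
      by rewrite -scalerN lev_wpscale2l.
    by rewrite -scaleNr lev_wpscale2l // oppr_ge0 ltW.
  rewrite linearZ; case: (ger0P a) => a0; first by rewrite lev_wpscale2l.
  by rewrite -[a in a *: y]opprK scaleNr -scalerN lev_wpscale2l // oppr_ge0 ltW.
have [a0|a0] := eqVneq a 0.
  have [x [nxy yx]] := cover_abs_majorizing icover y.
  by have := dom x nxy yx; rewrite a0 normr0 !mul0r.
have na0 : 0 < `|a| by rewrite normr_gt0.
rewrite mulrC -ler_pdivrMr //; apply: le_regular_ext => x nxy yx.
by rewrite ler_pdivrMr // mulrC dom.
Qed.

Lemma regular_ext_seminorm : seminorm (regular_ext i p).
Proof.
split=> [y|y y'|a y]; first exact: regular_ext_ge0.
  exact: regular_ext_add.
apply/eqP; rewrite eq_le regular_ext_scale_le /=.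
have [->|a0] := eqVneq a 0; first by rewrite normr0 mul0r regular_ext_ge0.
(* The other inequality follows by scaling back with [a^-1]. *)
rewrite mulrC -ler_pdivlMr ?normr_gt0 // mulrC -normfV.
by have := regular_ext_scale_le a^-1 (a *: y); rewrite scalerK.
Qed.

End RegularExtension.

Theorem theorem3p3 (R : realType) (X : povectType R) (p : X -> R)
    (Y : vlatticeType R) (i : {linear X -> Y}) :
  archimedean_pov X -> pre_riesz X -> pervasive X ->
  seminorm p -> semimonotone p ->
  vector_lattice_cover i ->
  order_continuous p ->
  seminorm (regular_ext i p) /\ order_continuous (regular_ext i p).
Proof.
move=> archX _ pervX psn _ icover pcont.
split; first exact: regular_ext_seminorm.
move=> I leI y l _ [J [leJ [z [dirJ zdec zy]]]] eps eps0.
have [b [x [zx px]]] :=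
  order_continuous_small_bound archX pervX icover dirJ zdec psn pcont eps0.
have [a0 ya0] := zy b; exists a0 => a /ya0[yz nyz].
rewrite ger0_norm ?regular_ext_ge0 //.
apply: le_lt_trans px; apply: regular_ext_le => //; last exact: le_trans zx.
by rewrite -lev_opp opprK; apply: le_trans zx.
Qed.
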